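(* Fix a polynomial $\sigma$. There exist constants $c>0$ and $d_0\in\mathbb{N}$ (depending only on $\sigma$) such that the following holds. For each odd $d\in\mathbb{N}$ there exist formulations of nonempty polytopes $P_1,P_2\subseteq\mathbb{R}^d$, of size $f_1$ and $f_2$ respectively, such that any MIP representation of $P_1\cup P_2$ with at most $\sigma(f_1+f_2)$ inequalities that has the convex hull property has $\Omega(d)$ additional variables, i.e. has at least $c\,d$ additional variables whenever $d\ge d_0$.
   Context: For a set $X$, $\operatorname{conv}(X)$ is its convex hull, and $\operatorname{proj}_x$ denotes the orthogonal projection onto the space of the $x$-variables. Given a polytope $P\subseteq\mathbb{R}^d$, a polytope $Q\subseteq\mathbb{R}^{d+m}$ (with $m\ge 0$) is a linear extension of $P$ with $m$ additional variables if $P=\operatorname{proj}_x(Q):=\{x\in\mathbb{R}^d:\exists\,y\in\mathbb{R}^m\text{ such that }(x,y)\in Q\}$; the case $Q=P$ is allowed. A formulation of $P$ is a (finite) system of linear inequalities describing a linear extension $Q$ of $P$; its size is the number of inequalities in the system. A MIP (mixed-integer programming) representation of a set $S\subseteq\mathbb{R}^d$ is given by real matrices $A,B,C$ and a vector $h$ such that, with $Q:=\{(x,y,z):Ax+By+Cz\le h,\ z\text{ integral}\}$ and $x\in\mathbb{R}^d$, one has $S=\operatorname{proj}_x(Q)$. Its number of inequalities is the number of rows of the system $Ax+By+Cz\le h$, and its number of additional variables is the total number of components of $y$ and $z$. A MIP representation of $P_1\cup P_2$ (where $P_1,P_2$ are nonempty polytopes) always satisfies $\operatorname{conv}(P_1\cup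 P_2)\subseteq\operatorname{proj}_x(\{(x,y,z):Ax+By+Cz\le h\})$; it has the convex hull property if these two sets coincide. *)

(* Defs.v *)
From HB Require Import structures.
From mathcomp Require Import all_boot all_order all_algebra.
From mathcomp Require Import all_classical all_reals all_analysis.

Set Implicit Arguments.
Unset Strict Implicit.
Unset Printing Implicit Defensive.

Import Order.TTheory GRing.Theory Num.Theory.
Import numFieldNormedType.Exports.

Local Open Scope classical_set_scope.
Local Open Scope ring_scope.

Section Polytopes.
Variable R : realType.

Definition convex_hull n (X : set 'cV[R]_n) : set 'cV[R]_n :=
  \bigcap_(K in [set K : set (convex_lmodType 'cV[R]_n) |
                 convex_set K /\ X `<=` K]) K.

(* The rows of [A v <= b] are compared entrywise: there is no library order on
   matrices. *)
Definition polyhedron k n (A : 'M[R]_(k, n)) (b : 'cV[R]_k) : set 'cV[R]_n :=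
  [set v | forall i, (A *m v) i 0 <= b i 0].

(* Polytopes are bounded polyhedra (possibly empty, of any dimension). *)
Definition polytope n (P : set 'cV[R]_n) : Prop :=
  (exists k (A : 'M[R]_(k, n)) (b : 'cV[R]_k), P = polyhedron A b) /\
  bounded_set P.

(* A point (x, y) of R^d x R^m is the stacked vector [col_mx x y]. *)
Definition proj_x d m (Q : set 'cV[R]_(d + m)) : set 'cV[R]_d :=
  [set x | exists y : 'cV[R]_m, Q (col_mx x y)].

Definition linear_extension d m (P : set 'cV[R]_d) (Q : set 'cV[R]_(d + m)) :
    Prop :=
  [/\ polytope P, polytope Q & P = proj_x Q].

(* The size of the formulation [F v <= g] of [P] is its number of rows [f]. *)
Definition formulation d m f (P : set 'cV[R]_d)
    (F : 'M[R]_(f, d + m)) (g : 'cV[R]_f) : Prop :=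
  linear_extension P (polyhedron F g).

Section MIP.
Variables (d p q r : nat).
Variables (A : 'M[R]_(r, d)) (B : 'M[R]_(r, p)) (C : 'M[R]_(r, q)).
Variable h : 'cV[R]_r.

Definition mip_ineqs (x : 'cV[R]_d) (y : 'cV[R]_p) (z : 'cV[R]_q) : Prop :=
  forall i, (A *m x + B *m y + C *m z) i 0 <= h i 0.

Definition mip_representation (S : set 'cV[R]_d) : Prop :=
  S = [set x | exists y z,
         mip_ineqs x y z /\ forall j, z j 0 \is a Num.int].

Definition convex_hull_property (P1 P2 : set 'cV[R]_d) : Prop :=
  convex_hull (P1 `|` P2) = [set x | exists y z, mip_ineqs x y z].

End MIP.

End Polytopes.

(* Main.v *)
Require Import Defs.
From HB Require Import structures.
From mathcomp Require Import all_boot all_order all_algebra.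
From mathcomp Require Import all_classical all_reals all_analysis.
From mathcomp Require Import zify ring lra.

Set Implicit Arguments.
Unset Strict Implicit.
Unset Printing Implicit Defensive.

Import Order.TTheory GRing.Theory Num.Theory.
Import numFieldNormedType.Exports.

Local Open Scope classical_set_scope.
Local Open Scope ring_scope.

(** A system of [r] inequalities with [m] additional variables projects onto a
    polyhedron with at most [(r + 1) ^ (m + 1)] facets. Indeed a facet
    inequality of the projection is a combination of rows in which the
    additional variables cancel. Among the rows tight on the whole lifted
    facet, the cancelling combinations yield only the multiples of that
    inequality, and a smallest set of rows giving it has at most [m + 1]
    elements: on [m + 2] rows there is a combination that cancels the [m]
    additional variables and the whole inequality too, and it can be used to
    remove one row. Such a set of rows determines the facet
    ([facet_eliminates], [small_eliminating_set], [facets_le]).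

    It remains to find two polytopes with few inequalities such that the convex
    hull of their union has very many facets. In dimension [2 n + 1], with
    coordinates [(u, v, t)], the first polytope lies in the hyperplane [t = 1]
    and is the product of [n] polygons cut out, inside a box, by the [f]
    inequalities [k u_i - v_i <= k ^ 2]. The second lies in [t = 0]; it is
    [n]-dimensional, with [u = 0], and has the facet [\sum_i v_i = 0]. Choosing
    one edge [s_i] in each polygon gives a product of edges, and adding up their
    inequalities gives a functional whose restriction to the [v]-coordinates is
    [- \sum_i v_i], whatever the choice. Hence that one facet of the second
    polytope completes each of the [f ^ n] products of edges to a facet of the
    convex hull of the union ([facet_row_face]).

    The total size of the two descriptions is [O(n + n f)]. As the number [f]
    of edges is free, it is taken so large, in terms of the polynomial and the
    dimension, that a polynomial bound on the number [r] of rows implies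
    [r + 1 <= f ^ K] with [K] depending on the degree of the polynomial only.
    Then [f ^ n <= (r + 1) ^ (m + 1)] forces [n <= K (m + 1)], so that [m] is
    at least linear in the dimension. *)

(** * Facets of a projection *)

Section Elimination.
Variables (R : fieldType) (r d m : nat).
Implicit Types (I J : {set 'I_r}) (l : 'rV[R]_r).

Definition supported_on I l : Prop := forall i, i \notin I -> l 0 i = 0.

(** For a system with rows [A x + B w], the functional [a] in [x] alone arises
    from the rows in [I] by eliminating the variables [w]. Multipliers of both
    signs are allowed, unlike in Fourier-Motzkin elimination. *)
Definition eliminates (A : 'M[R]_(r, d)) (B : 'M[R]_(r, m)) I
    (a : 'rV[R]_d) : Prop :=
  exists l, [/\ supported_on I l, l *m B = 0 & l *m A = a].

Lemma dependent_rows k (X : 'M[R]_(r, k)) J : (k < #|J|)%N ->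
  exists l, [/\ l != 0, supported_on J l & l *m X = 0].
Proof.
move=> ltkJ; pose f (i : 'I_#|J|) := enum_val i.
have : kermx (rowsub f X) != 0.
  rewrite kermx_eq0 /row_free neq_ltn.
  by rewrite (leq_ltn_trans (rank_leq_col _) ltkJ).
case/rowV0Pn=> v /sub_kermxP vX v0.
have lE i : (v *m rowsub f 1%:M) 0 (f i) = v 0 i.
  rewrite mxE (bigD1 i) //= !mxE eqxx mulr1 big1 ?addr0 // => j ji.
  by rewrite !mxE (inj_eq enum_val_inj) (negbTE ji) mulr0.
exists (v *m rowsub f 1%:M); split.
- case/rV0Pn: v0 => i vi; apply/rV0Pn; exists (f i).
  by rewrite lE.
- move=> i iJ; rewrite mxE big1 // => j _; rewrite !mxE.
  case: eqP => [fji|]; last by rewrite mulr0.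
  by rewrite -fji enum_valP in iJ.
- by rewrite -mulmxA mul_rowsub_mx mul1mx.
Qed.

(** A smallest set of rows from which [a] arises has at most [m + 1] elements.
    On a larger set there is a nonzero combination that cancels the [m] columns
    of [B] and one coordinate [j] with [a_j] nonzero; as it gives a multiple of
    [a], it gives [0], and subtracting a multiple of it removes a row. *)
Lemma small_eliminating_set (A : 'M[R]_(r, d)) (B : 'M[R]_(r, m)) I a : a != 0 ->
    eliminates A B I a ->
    (forall a', eliminates A B I a' -> exists t, a' = t *: a) ->
  exists J, [/\ J \subset I, (#|J| <= m.+1)%N & eliminates A B J a].
Proof.
case/rV0Pn=> j aj elI uniqI.
pose P k := `[< exists J, [/\ J \subset I, #|J| = k & eliminates A B J a] >].
have exP : exists k, P k by exists #|I|; apply/asboolP; exists I.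
case: (ex_minnP exP) => k /asboolP[J [JI cJ elJ]] kmin.
exists J; split=> //; rewrite leqNgt; apply/negP => ltJ.
have ltJ1 : (m + 1 < #|J|)%N by rewrite addn1.
have [mu [/rV0Pn[i mui] supmu]] := dependent_rows (row_mx B (col j A)) ltJ1.
rewrite mul_mx_row -[0 in RHS]row_mx0 => /eq_row_mx[muB mucA].
have muA : mu *m A = 0.
  have [|t tE] := uniqI (mu *m A).
    exists mu; split=> // i0 i0I; apply: supmu; apply: contra i0I.
    exact: (fintype.subsetP JI).
  have : (mu *m A) 0 j = 0.
    by move: mucA; rewrite colE mulmxA -colE => /matrixP/(_ 0 0); rewrite !mxE.
  rewrite tE mxE => /eqP; rewrite mulf_eq0 (negbTE aj) orbF => /eqP ->.
  by rewrite scale0r.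
have iJ : i \in J by apply: contraNT mui => /supmu ->.
case: elJ => l [supl lB lA].
suff : P #|J :\ i|.
  by move/kmin; rewrite -cJ (cardsD1 i J) iJ ltnn.
apply/asboolP; exists (J :\ i); split=> //.
  exact: fintype.subset_trans (subD1set _ _) JI.
exists (l - (l 0 i / mu 0 i) *: mu); split.
- move=> i0; rewrite !inE negb_and negbK !mxE => /orP[/eqP ->|i0J].
    by rewrite mulfVK // subrr.
  by rewrite (supl _ i0J) (supmu _ i0J) mulr0 subr0.
- by rewrite mulmxBl -scalemxAl lB muB scaler0 subr0.
- by rewrite mulmxBl -scalemxAl lA muA scaler0 subr0.
Qed.

End Elimination.

Lemma card_small_sets (T : finType) k :
  (#|[set J : {set T} | (#|J| <= k)%N]%SET| <= #|T|.+1 ^ k)%N.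
Proof.
pose im (g : {ffun 'I_k -> option T}) : {set T} :=
  [set i | Some i \in codom g]%SET.
have sub : [set J : {set T} | (#|J| <= k)%N]%SET \subset
    im @: [set: {ffun 'I_k -> option T}]%SET.
  apply/fintype.subsetP => J; rewrite inE => cJ.
  pose g := [ffun i : 'I_k => nth None [seq Some j | j <- enum J] i].
  apply/imsetP; exists g; rewrite ?inE //; apply/finset.setP => j; rewrite inE.
  apply/idP/codomP => [jJ|[i]].
    have jlt : (index j (enum J) < k)%N.
      by rewrite (leq_trans _ cJ) // cardE index_mem mem_enum.
    exists (Ordinal jlt).
    by rewrite ffunE /= (nth_map j) ?nth_index ?index_mem ?mem_enum.
  rewrite ffunE => jE.
  have [lti|gei] := ltnP i (size (enum J)).
    have : Some j \in [seq Some j | j <- enum J].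
      by rewrite jE; apply: mem_nth; rewrite size_map.
    by case/mapP => j' + [->]; rewrite mem_enum.
  by rewrite nth_default ?size_map in jE.
apply: leq_trans (subset_leq_card sub) _; apply: leq_trans (leq_imset_card _ _) _.
by rewrite finset.cardsT card_ffun card_option !card_ord.
Qed.

(** A ratio test: from a point with slacks [g] there is room for a positive step
    in the direction that changes the slacks at the rates [c]. *)
Lemma small_step (R : realFieldType) (T : finType) (P : pred T) (g c : T -> R) :
  (forall i, P i -> 0 < g i) ->
  exists e, 0 < e /\ forall i, P i -> e * c i <= g i.
Proof.
move=> gpos; pose S := \sum_(i | P i) `|c i| / g i.
have S0 : 0 <= S.
  by apply: sumr_ge0 => i Pi; rewrite divr_ge0 // ltW // gpos.
have S1 : 0 < 1 + S by rewrite ltr_pwDl.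
exists (1 + S)^-1; split=> [|i Pi]; first by rewrite invr_gt0.
rewrite mulrC ler_pdivrMr // mulrC -ler_pdivrMr ?gpos //.
have leS : `|c i| / g i <= S.
  rewrite /S (bigD1 i) //= lerDl; apply: sumr_ge0 => j /andP[Pj _].
  by rewrite divr_ge0 // ltW // gpos.
apply: le_trans (_ : `|c i| / g i <= _); last by rewrite (le_trans leS) // lerDr.
by rewrite ler_wpM2r ?ler_norm // invr_ge0 ltW // gpos.
Qed.

Section FacetCounting.
Variables (R : realFieldType) (r d m : nat).

Definition shadow (A : 'M[R]_(r, d)) (B : 'M[R]_(r, m)) (h : 'cV[R]_r) :
    set 'cV[R]_d :=
  [set x | exists w : 'cV[R]_m, forall i, (A *m x + B *m w) i 0 <= h i 0].

(** The valid inequality [a x <= b] defines a facet of [S]. That the points of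
    equality span a hyperplane is expressed dually, by the functionals that are
    constant on them. *)
Definition facet_defining (S : set 'cV[R]_d) (a : 'rV[R]_d) (b : R) : Prop :=
  [/\ exists x, S x /\ (a *m x) 0 0 = b,
      forall x, S x -> (a *m x) 0 0 <= b &
      forall (a' : 'rV[R]_d) b',
        (forall x, S x -> (a *m x) 0 0 = b -> (a' *m x) 0 0 = b') ->
        exists t, a' = t *: a].

(** The rows [I] are those tight at a point of the lifted face where their
    number is minimal, hence at every point of that face (average with the
    given point). So combinations of them that cancel [B] are constant on the
    face, and are multiples of [a]. Conversely, a direction orthogonal to the
    rows in [I] can be followed both ways inside the system, so it is orthogonal
    to [a], which therefore lies in the span of these rows. *)
Lemma facet_eliminates (A : 'M[R]_(r, d)) (B : 'M[R]_(r, m)) (h : 'cV[R]_r) a b :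
    facet_defining (shadow A B h) a b ->
  exists I, eliminates A B I a /\
    forall a', eliminates A B I a' -> exists t, a' = t *: a.
Proof.
case=> -[x0 [[w0 Q0] ax0]] valid span.
pose tight (x : 'cV[R]_d) (w : 'cV[R]_m) : {set 'I_r} :=
  [set i | (A *m x + B *m w) i 0 == h i 0]%SET.
pose Q (x : 'cV[R]_d) (w : 'cV[R]_m) := forall i, (A *m x + B *m w) i 0 <= h i 0.
pose P k := `[< exists x w, [/\ Q x w, (a *m x) 0 0 = b & #|tight x w| = k] >].
have exP : exists k, P k by exists #|tight x0 w0|; apply/asboolP; exists x0, w0.
case: (ex_minnP exP) => k /asboolP[x [w [Qxw axb cI]]] kmin.
have tightS x' w' : Q x' w' -> (a *m x') 0 0 = b -> tight x w \subset tight x' w'.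
  move=> Q' ax'.
  pose y := 2^-1 *: (x + x'); pose z := 2^-1 *: (w + w').
  have yz i : (A *m y + B *m z) i 0 =
      2^-1 * ((A *m x + B *m w) i 0 + (A *m x' + B *m w') i 0).
    rewrite -!scalemxAr -scalerDr !mulmxDr addrACA [LHS]mxE; congr (_ * _).
    by rewrite mxE.
  have Qyz : Q y z by move=> i; rewrite yz; have := Qxw i; have := Q' i; lra.
  have ayz : (a *m y) 0 0 = b.
    by rewrite -scalemxAr mulmxDr mxE mxE axb ax'; lra.
  have cyz : (#|tight x w| <= #|tight y z|)%N.
    by rewrite cI; apply: kmin; apply/asboolP; exists y, z.
  have tyz : tight y z \subset tight x w :&: tight x' w'.
    apply/fintype.subsetP => i; rewrite !inE yz.
    have := Qxw i; have := Q' i => q1 q2 /eqP e.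
    by apply/andP; split; apply/eqP; lra.
  have eqt : tight x w :&: tight x' w' == tight x w.
    rewrite eqEcard subsetIl (leq_trans cyz) //; exact: subset_leq_card.
  by rewrite -(eqP eqt) subsetIr.
exists (tight x w); split; last first.
  move=> _ [l [supl lB <-]]; apply: (span _ ((l *m h) 0 0)) => x' [w' Q'] ax'.
  have -> : l *m A *m x' = l *m (A *m x' + B *m w').
    by rewrite mulmxDr !mulmxA lB mul0mx addr0.
  rewrite !mxE; apply: eq_bigr => i _.
  have [iI|/supl ->] := boolP (i \in tight x w); last by rewrite !mul0r.
  have := fintype.subsetP (tightS _ _ Q' ax') i iI; rewrite inE => /eqP ->.
  by [].
(* Multiplication by [D] keeps the tight rows and replaces the others by 0. *)
pose M := row_mx A B; pose D := diag_mx (\row_i (i \in tight x w)%:R : 'rV[R]_r).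
have DE n (X : 'M[R]_(r, n)) i j : (D *m X) i j = (i \in tight x w)%:R * X i j.
  by rewrite /D mul_diag_mx !mxE.
have step (v : 'cV[R]_(d + m)) :
    D *m M *m v = 0 -> (row_mx a (0 : 'rV[R]_m) *m v) 0 0 <= 0.
  move=> DMv.
  pose g i := h i 0 - (A *m x + B *m w) i 0.
  have [|e [e0 eg]] := @small_step _ _ [pred i | i \notin tight x w] g
    (fun i => (M *m v) i 0).
    move=> i /=; rewrite inE subr_gt0 => ne.
    by rewrite lt_neqAle ne Qxw.
  have Me i : (A *m (x + e *: usubmx v) + B *m (w + e *: dsubmx v)) i 0 =
      (A *m x + B *m w) i 0 + e * (M *m v) i 0.
    rewrite -{3}[v]vsubmxK /M mul_row_col !mulmxDr -!scalemxAr addrACA -scalerDr.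
    by rewrite [LHS]mxE; congr (_ + _); rewrite mxE.
  have : (a *m (x + e *: usubmx v)) 0 0 <= b.
    apply: valid; exists (w + e *: dsubmx v) => i; rewrite Me.
    have [iI|iI] := boolP (i \in tight x w).
      have := congr1 (fun X : 'cV_r => X i 0) DMv.
      rewrite -mulmxA DE iI mul1r [RHS]mxE => ->; rewrite mulr0 addr0; exact: Qxw.
    by have := eg i iI; rewrite /g; lra.
  rewrite mulmxDr -scalemxAr mxE axb [X in _ + X]mxE gerDl pmulr_rle0 //.
  by rewrite -{2}[v]vsubmxK mul_row_col mul0mx addr0.
have kill (v : 'cV[R]_(d + m)) : D *m M *m v = 0 -> row_mx a (0 : 'rV[R]_m) *m v = 0.
  move=> DMv; apply/matrixP => i j; rewrite !ord1 [RHS]mxE.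
  apply/eqP; rewrite eq_le step //= -oppr_le0.
  have := step (- v); rewrite !mulmxN DMv oppr0 => /(_ erefl).
  by rewrite mxE.
have : (row_mx a (0 : 'rV[R]_m) <= D *m M)%MS.
  rewrite submxE; apply/eqP/matrixP => i j.
  have := kill (col j (cokermx (D *m M))).
  rewrite colE (mulmxA (D *m M)) mulmx_coker mul0mx (mulmxA (row_mx a 0)) -colE.
  move=> /(_ erefl)/matrixP/(_ i 0).
  by rewrite mxE => ->; rewrite !mxE.
case/submxP => u; rewrite mulmxA mul_mx_row => /eq_row_mx[aE BE].
exists (u *m D); split=> // i iI.
by rewrite /D mul_mx_diag !mxE (negbTE iI) mulr0.
Qed.

(** The eliminations from the small set of rows chosen for a facet yield only
    multiples of its inequality, so different facets get different sets. *)
Lemma facets_le (T : finType) (A : 'M[R]_(r, d)) (B : 'M[R]_(r, m)) (h : 'cV[R]_r)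
    (a : T -> 'rV[R]_d) (b : T -> R) :
    (forall s, a s != 0) ->
    (forall s, facet_defining (shadow A B h) (a s) (b s)) ->
    (forall s s' t, a s = t *: a s' -> s = s') ->
  (#|T| <= r.+1 ^ m.+1)%N.
Proof.
move=> a0 facet distinct.
have /choice[J JP] : forall s, exists J : {set 'I_r},
    [/\ (#|J| <= m.+1)%N, eliminates A B J (a s) &
      forall a', eliminates A B J a' -> exists t, a' = t *: a s].
  move=> s; have [I [elI uniqI]] := facet_eliminates (facet s).
  have [J [JI cJ elJ]] := small_eliminating_set (a0 s) elI uniqI.
  exists J; split=> // a' [l [supl lB lA]]; apply: uniqI; exists l; split=> // i iI.
  by apply: supl; apply: contra iI; exact: (fintype.subsetP JI).
have Jinj : injective J.
  move=> s s' ss'; have [_ els _] := JP s; have [_ _ uniqs'] := JP s'.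
  by rewrite ss' in els; have [t /distinct] := uniqs' _ els.
rewrite -finset.cardsT -(card_imset _ Jinj).
have := card_small_sets 'I_r m.+1; rewrite card_ord; apply: leq_trans.
apply/subset_leq_card/fintype.subsetP => _ /imsetP[s _ ->].
by rewrite inE; case: (JP s).
Qed.

End FacetCounting.

(** * Convex hulls and boxed polytopes *)

Section BoxedPolytopes.
Variables (R : realType) (d : nat).

(** The rows are indexed by an arbitrary finite type, which spares encoding
    structured families of inequalities as ordinals. *)
Definition boxed (lo hi : 'cV[R]_d) (T : finType) (a : T -> 'rV[R]_d) (b : T -> R) :
    set 'cV[R]_d :=
  [set x : 'cV[R]_d | (forall j, lo j 0 <= x j 0 <= hi j 0) /\
    forall t, (a t *m x) 0 0 <= b t].

Lemma convex_hull_incl (X : set 'cV[R]_d) : X `<=` convex_hull X.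
Proof. by move=> x Xx K [_ XK]; exact: XK. Qed.

Lemma convex_hull_halfspace (X : set 'cV[R]_d) (a : 'rV[R]_d) b :
  (forall x, X x -> (a *m x) 0 0 <= b) ->
  forall x, convex_hull X x -> (a *m x) 0 0 <= b.
Proof.
move=> Xab x /(_ [set y : 'cV[R]_d | (a *m y) 0 0 <= b]); apply.
split; last by move=> y /Xab.
move=> y z t; rewrite !inE /= => yab zab.
change (is_true ((a *m
  (t%:num *: (y : 'cV[R]_d) + (1 - t%:num) *: (z : 'cV[R]_d))) 0 0 <= b)).
rewrite mulmxDr -!scalemxAr mxE [X in X + _]mxE [X in _ + X]mxE.
have -> : b = t%:num * b + (1 - t%:num) * b by ring.
by apply: lerD; apply: ler_wpM2l.
Qed.

(** A formulation of [boxed] by itself; the box is there to make any such system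
    of inequalities describe a polytope. *)
Lemma boxed_formulation lo hi (T : finType) (a : T -> 'rV[R]_d) (b : T -> R) :
  exists (F : 'M[R]_(d + d + #|T|, d + 0)) (g : 'cV[R]_(d + d + #|T|)),
    formulation (boxed lo hi a b) F g.
Proof.
pose A : 'M[R]_(d + d + #|T|, d) :=
  col_mx (col_mx (- 1%:M) 1%:M) (\matrix_k a (enum_val k)).
pose g : 'cV[R]_(d + d + #|T|) :=
  col_mx (col_mx (- lo) hi) (\col_k b (enum_val k)).
have rowE (x : 'cV[R]_d) k :
    ((\matrix_k0 a (enum_val k0)) *m x) k 0 = (a (enum_val k) *m x) 0 0.
  by rewrite !mxE; apply: eq_bigr => j _; rewrite !mxE.
have PE : boxed lo hi a b = polyhedron A g.
  apply/seteqP; split=> x /=; rewrite /boxed /polyhedron /=.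
    move=> [box rows] i; rewrite /A /g !mul_col_mx mulNmx !mul1mx.
    case: (split_ordP i) => {}i ->; last first.
      by rewrite !col_mxEd rowE [leRHS]mxE.
    rewrite !col_mxEu; case: (split_ordP i) => {}i ->.
      by rewrite !col_mxEu !mxE lerN2; case/andP: (box i).
    by rewrite !col_mxEd; case/andP: (box i).
  move=> rows; split=> [j|t].
    have := rows (lshift _ (lshift _ j)); have := rows (lshift _ (rshift _ j)).
    rewrite /A /g !mul_col_mx mulNmx !mul1mx !(col_mxEu, col_mxEd) !mxE lerN2.
    by move=> -> ->.
  have := rows (rshift _ (enum_rank t)).
  by rewrite /A /g mul_col_mx !col_mxEd rowE [leRHS]mxE enum_rankK.
have QE : polyhedron (row_mx A (0 : 'M[R]_(_, 0))) g =
    [set v | polyhedron A g (usubmx v)].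
  have ext v : row_mx A (0 : 'M[R]_(_, 0)) *m v = A *m usubmx v.
    by rewrite -{1}[v]vsubmxK mul_row_col mul0mx addr0.
  by apply/seteqP; split=> v; rewrite /polyhedron /= ext.
pose W := \sum_j (`|lo j 0| + `|hi j 0|).
have boxW x : boxed lo hi a b x -> forall j, `|x j 0| <= W.
  move=> [box _] j; have /andP[lox xhi] := box j.
  apply: (@le_trans _ _ (`|lo j 0| + `|hi j 0|)).
    rewrite ler_norml; have := ler_norm (hi j 0); have := ler_norm (- lo j 0).
    rewrite normrN; have := normr_ge0 (lo j 0); have := normr_ge0 (hi j 0).
    by move=> ? ? ? ?; apply/andP; split; lra.
  by rewrite /W (bigD1 j) //= lerDl sumr_ge0 // => k _; rewrite addr_ge0.
have W0 : 0 <= W by rewrite sumr_ge0 // => k _; rewrite addr_ge0.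
have bnd n (S : set 'cV[R]_n) :
    (forall x, S x -> forall j, `|x j 0| <= W) -> bounded_set S.
  move=> SW; exists W; split=> [|M WM x Sx]; first exact: num_real.
  change (is_true (mx_norm x <= M)); rewrite mx_normrE; apply: bigmax_le.
    exact: le_trans (ltW WM).
  by move=> [i j] _ /=; rewrite ord1 (le_trans (SW _ Sx i)) // ltW.
have bP : polytope (boxed lo hi a b).
  by split; [exists _, A, g | exact: bnd].
exists (row_mx A 0), g; split=> //.
- split; first by exists _, (row_mx A 0), g.
  apply: bnd; rewrite QE => v /=; rewrite -PE => /boxW vW j.
  by rewrite -[v]vsubmxK; case: (split_ordP j) => [{}j|[]//] ->; rewrite col_mxEu.
- rewrite QE PE; apply/seteqP; split=> x; rewrite /proj_x /=.
    by exists 0; rewrite col_mxKu.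
  by case=> y; rewrite col_mxKu.
Qed.

End BoxedPolytopes.

(** * Two polytopes with many facets in the hull of their union *)

Section HardPolytopes.
Variables (R : realType) (n f : nat).
Implicit Types (s : {ffun 'I_n -> 'I_f}) (e : 'I_n -> bool) (x : 'cV[R]_(n + n + 1)).

Definition ucoord (i : 'I_n) : 'I_(n + n + 1) := lshift 1 (lshift n i).
Definition vcoord (i : 'I_n) : 'I_(n + n + 1) := lshift 1 (rshift n i).
Definition tcoord : 'I_(n + n + 1) := rshift (n + n) 0.

Lemma coord_ind (P : 'I_(n + n + 1) -> Prop) :
  (forall i, P (ucoord i)) -> (forall i, P (vcoord i)) -> P tcoord ->
  forall j, P j.
Proof.
move=> Pu Pv Pt j; case: (split_ordP j) => {}j ->; last by rewrite ord1.
by case: (split_ordP j) => {}j ->; [exact: Pu|exact: Pv].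
Qed.

Definition pt (u v : 'I_n -> R) (t : R) : 'cV[R]_(n + n + 1) :=
  col_mx (col_mx (\col_i u i) (\col_i v i)) t%:M.

Lemma pt_u u v t i : pt u v t (ucoord i) 0 = u i.
Proof. by rewrite !col_mxEu mxE. Qed.
Lemma pt_v u v t i : pt u v t (vcoord i) 0 = v i.
Proof. by rewrite col_mxEu col_mxEd mxE. Qed.
Lemma pt_t u v t : pt u v t tcoord 0 = t.
Proof. by rewrite col_mxEd mxE. Qed.
Definition ptE := (pt_u, pt_v, pt_t).

Lemma row_mulE (a : 'rV[R]_(n + n + 1)) x :
  (a *m x) 0 0 =
  \sum_i (a 0 (ucoord i) * x (ucoord i) 0 + a 0 (vcoord i) * x (vcoord i) 0)
  + a 0 tcoord * x tcoord 0.
Proof. by rewrite mxE !big_split_ord /= big_ord1 big_split. Qed.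

Lemma row_ptE u v t x :
  ((pt u v t)^T *m x) 0 0 =
  \sum_i (u i * x (ucoord i) 0 + v i * x (vcoord i) 0) + t * x tcoord 0.
Proof.
rewrite row_mulE [X in _ + X * _]mxE pt_t; congr (_ + _).
by apply: eq_bigr => i _; rewrite [X in X * _ + _]mxE [X in _ + X * _]mxE !ptE.
Qed.

(** The edge of slope [k] of the [i]-th polygon lies on the line
    [v = k u - k ^ 2], the tangent to [v = u ^ 2 / 4] at [u = 2 k]. *)
Definition slope_row (ik : 'I_n * 'I_f) : 'rV[R]_(n + n + 1) :=
  (pt (fun j => (j == ik.1)%:R * (ik.2 : nat)%:R) (fun j => - (j == ik.1)%:R) 0)^T.

(** Any bound large enough not to cut the points [edge_point] off. *)
Definition box_bound : R := (f.+1 ^ 2)%:R.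

Definition polygon_product : set 'cV[R]_(n + n + 1) :=
  boxed (pt (fun=> 0) (fun=> 0) 1) (pt (fun=> box_bound) (fun=> box_bound) 1)
    slope_row (fun ik => (ik.2 : nat)%:R ^+ 2).

(** Any polytope in [u = 0], [t = 0] having [\sum_i v_i >= 0] as a facet would
    serve; this one is the upper half of a cube. *)
Definition slice_polytope : set 'cV[R]_(n + n + 1) :=
  boxed (pt (fun=> 0) (fun=> -1) 0) (pt (fun=> 0) (fun=> 1) 0)
    (fun _ : unit => (pt (fun=> 0) (fun=> -1) 0)^T) (fun=> 0).

Lemma slope_rowE ik x :
  (slope_row ik *m x) 0 0 = (ik.2 : nat)%:R * x (ucoord ik.1) 0 - x (vcoord ik.1) 0.
Proof.
rewrite row_ptE mul0r addr0 (bigD1 ik.1) //= eqxx mul1r mulN1r big1 ?addr0 //.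
by move=> j /negbTE ->; rewrite !mul0r oppr0 mul0r addr0.
Qed.

(** The sum of the inequalities of the chosen edges, made homogeneous with [t],
    so that it vanishes at the origin, a point of the second polytope. *)
Definition facet_row s : 'rV[R]_(n + n + 1) :=
  (pt (fun i => (s i : nat)%:R) (fun=> -1) (- \sum_i (s i : nat)%:R ^+ 2))^T.

(** Tangents of consecutive integral slopes [k] and [k + 1] meet at
    [u = 2 k + 1]; so for each [i] the two values of [e i] give two points of
    the edge [s i], its tangency point and the point where the next slope takes
    over. *)
Definition edge_point s e : 'cV[R]_(n + n + 1) :=
  pt (fun i => (2 * s i + e i)%:R) (fun i => (s i ^ 2 + e i * s i)%:R) 1.

(** Differences of two basis vectors in the [v]-coordinates (roots of type A);
    they span the hyperplane [\sum_i v_i = 0]. *)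
Definition root_point (i j : 'I_n) : 'cV[R]_(n + n + 1) :=
  pt (fun=> 0) (fun k => (k == i)%:R - (k == j)%:R) 0.

Lemma sum_pick (g : 'I_n -> R) j : \sum_k g k * (k == j)%:R = g j.
Proof.
by rewrite (bigD1 j) //= eqxx mulr1 big1 ?addr0 // => k /negbTE ->; rewrite mulr0.
Qed.

Lemma sum_delta (j : 'I_n) : \sum_k (k == j)%:R = 1 :> R.
Proof.
by rewrite -[RHS](sum_pick (fun=> 1) j); apply: eq_bigr => k _; rewrite mul1r.
Qed.

Lemma edge_point_in s e : polygon_product (edge_point s e).
Proof.
split=> [j|[i k]].
  elim/coord_ind: j => [i|i|]; rewrite !ptE ?lexx //; have := ltn_ord (s i) => sf.
    by rewrite ler0n /box_bound ler_nat; case: (e i); nia.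
  by rewrite ler0n /box_bound ler_nat; case: (e i); nia.
rewrite slope_rowE /= !ptE -natrX -natrM lerBlDr -natrD ler_nat.
case: (e i); rewrite ?mul0n ?mul1n ?addn0.
  by case: (leqP k (s i)); nia.
by case: (leqP k (s i)); nia.
Qed.

Lemma root_point_in i j : slice_polytope (root_point i j).
Proof.
split=> [k|_].
  elim/coord_ind: k => [k|k|]; rewrite !ptE ?lexx //.
  by case: (k == i); case: (k == j) => /=; apply/andP; split; lra.
rewrite row_ptE mul0r addr0 le_eqVlt; apply/orP; left; apply/eqP.
rewrite (eq_bigr (fun k => (k == j)%:R - (k == i)%:R)); last first.
  by move=> k _; rewrite !ptE; ring.
by rewrite sumrB !sum_delta subrr.
Qed.

Lemma slice_polytope0 : slice_polytope 0.
Proof.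
split=> [k|_]; last by rewrite mulmx0 mxE.
by elim/coord_ind: k => [k|k|]; rewrite !ptE !mxE; apply/andP; split; lra.
Qed.

Lemma polygon_product0 : polygon_product (pt (fun=> 0) (fun=> 0) 1).
Proof.
split=> [j|[i k]].
  by elim/coord_ind: j => [j|j|]; rewrite !ptE lexx // /box_bound ler0n.
by rewrite slope_rowE !ptE mulr0 subr0 sqr_ge0.
Qed.

Lemma facet_row_u s i : facet_row s 0 (ucoord i) = (s i : nat)%:R.
Proof. by rewrite mxE pt_u. Qed.
Lemma facet_row_v s i : facet_row s 0 (vcoord i) = -1.
Proof. by rewrite mxE pt_v. Qed.
Lemma facet_row_t s : facet_row s 0 tcoord = - \sum_i (s i : nat)%:R ^+ 2.
Proof. by rewrite mxE pt_t. Qed.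

Lemma facet_rowE s x : (facet_row s *m x) 0 0 =
  \sum_i ((s i : nat)%:R * x (ucoord i) 0 - x (vcoord i) 0
    - (s i : nat)%:R ^+ 2 * x tcoord 0).
Proof.
rewrite row_ptE sumrB mulNr mulr_suml; congr (_ - _).
by apply: eq_bigr => i _; rewrite mulN1r.
Qed.

Lemma facet_row_valid s x :
  (polygon_product `|` slice_polytope) x -> (facet_row s *m x) 0 0 <= 0.
Proof.
rewrite facet_rowE => -[[box rows]|[box rows]].
  apply: sumr_le0 => i _; have := rows (i, s i); rewrite slope_rowE /=.
  by have := box tcoord; rewrite !ptE => /le_anti <-; lra.
have t0 : x tcoord 0 = 0 by have := box tcoord; rewrite !ptE => /le_anti <-.
have u0 i : x (ucoord i) 0 = 0 by have := box (ucoord i); rewrite !ptE => /le_anti <-.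
apply: le_trans (rows tt); rewrite row_ptE t0 mulr0 addr0; apply: ler_sum => i _.
by rewrite u0 !mulr0 subr0 sub0r add0r mulN1r.
Qed.

Lemma facet_row_edge s e : (facet_row s *m edge_point s e) 0 0 = 0.
Proof.
rewrite facet_rowE big1 // => i _; rewrite !ptE !natrD !natrX !natrM; ring.
Qed.

Lemma facet_row_root s i j : (facet_row s *m root_point i j) 0 0 = 0.
Proof.
rewrite facet_rowE (eq_bigr (fun k => (k == j)%:R - (k == i)%:R)); last first.
  by move=> k _; rewrite !ptE; ring.
by rewrite sumrB !sum_delta subrr.
Qed.

(** The root points make the [v]-coefficients of [a] equal, moving along the
    edge [s i] gives the [i]-th [u]-coefficient, and the first polytope gives
    the [t]-coefficient. *)
Lemma facet_row_span s (i0 : 'I_n) (a : 'rV[R]_(n + n + 1)) b :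
  (forall e, (a *m edge_point s e) 0 0 = b) ->
  (forall i j, (a *m root_point i j) 0 0 = b) ->
  a = - a 0 (vcoord i0) *: facet_row s.
Proof.
move=> edges roots.
have rootE i j : a 0 (vcoord i) - a 0 (vcoord j) = b.
  rewrite -(roots i j) row_mulE !ptE mulr0 addr0.
  under eq_bigr do rewrite !ptE mulr0 add0r mulrBr.
  by rewrite sumrB !sum_pick.
have b0 : b = 0 by rewrite -(rootE i0 i0) subrr.
have vE i : a 0 (vcoord i) = a 0 (vcoord i0).
  by apply/eqP; rewrite -subr_eq0 rootE b0.
set c := a 0 (vcoord i0) in vE *.
have edgeE e : b = \sum_i (a 0 (ucoord i) * (2 * s i + e i)%:R
    + c * (s i ^ 2 + e i * s i)%:R) + a 0 tcoord.
  rewrite -(edges e) row_mulE !ptE mulr1; congr (_ + _).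
  by apply: eq_bigr => i _; rewrite !ptE vE.
have uE i : a 0 (ucoord i) = - c * (s i : nat)%:R.
  have := edgeE (fun k => k == i); rewrite (edgeE (fun=> false)) => /addIr.
  rewrite (bigD1 i) //= [RHS](bigD1 i) //= eqxx.
  rewrite [X in _ + X = _](eq_bigr (fun k => a 0 (ucoord k) * (2 * s k + (k == i))%:R
     + c * (s k ^ 2 + (k == i) * s k)%:R)); last by move=> k /negbTE ->.
  move=> /addIr; rewrite !natrD !natrX !natrM /= mulr1n mulr0n => H; lra.
have tE : a 0 tcoord = c * \sum_i (s i : nat)%:R ^+ 2.
  have := edgeE (fun=> false); rewrite b0 => /esym/eqP.
  rewrite addr_eq0 => /eqP/esym/eqP; rewrite eqr_oppLR => /eqP ->.
  rewrite -sumrN mulr_sumr; apply: eq_bigr => i _.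
  rewrite uE !natrD !natrX !natrM /= mulr0n; ring.
apply/rowP; elim/coord_ind => [i|i|]; rewrite [RHS]mxE.
- by rewrite facet_row_u uE.
- by rewrite facet_row_v vE mulrN1 opprK.
- by rewrite facet_row_t tE mulrNN.
Qed.

Lemma facet_row_face s (i0 : 'I_n) :
  facet_defining (convex_hull (polygon_product `|` slice_polytope)) (facet_row s) 0.
Proof.
split.
- exists (root_point i0 i0); split; last exact: facet_row_root.
  by apply: convex_hull_incl; right; exact: root_point_in.
- exact/convex_hull_halfspace/facet_row_valid.
- move=> a b ab; exists (- a 0 (vcoord i0)); apply: (@facet_row_span s i0 a b).
  + move=> e; apply: ab (facet_row_edge s e).
    by apply: convex_hull_incl; left; exact: edge_point_in.
  + move=> i j; apply: ab (facet_row_root s i j).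
    by apply: convex_hull_incl; right; exact: root_point_in.
Qed.

Lemma facet_row_inj s s' t : facet_row s = t *: facet_row s' -> s = s'.
Proof.
move=> st; apply/ffunP => i.
have := congr1 (fun a : 'rV_(n + n + 1) => a 0 (vcoord i)) st.
have := congr1 (fun a : 'rV_(n + n + 1) => a 0 (ucoord i)) st.
rewrite [RHS]mxE !facet_row_u => uE; rewrite [RHS]mxE !facet_row_v => vE.
have t1 : t = 1 by lra.
by move: uE; rewrite t1 mul1r => /eqP; rewrite eqr_nat => /eqP /val_inj.
Qed.

Lemma facet_row_neq0 s (i0 : 'I_n) : facet_row s != 0.
Proof.
apply/rV0Pn; exists (vcoord i0).
by rewrite facet_row_v oppr_eq0 oner_eq0.
Qed.

Lemma hull_facets_le r m (A : 'M[R]_(r, n + n + 1)) (B : 'M[R]_(r, m)) h :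
    (0 < n)%N -> convex_hull (polygon_product `|` slice_polytope) = shadow A B h ->
  (f ^ n <= r.+1 ^ m.+1)%N.
Proof.
move=> n0 hullE.
have := @facets_le _ _ _ _ _ A B h facet_row (fun=> 0).
rewrite card_ffun !card_ord; apply.
- by move=> s; exact: facet_row_neq0 (Ordinal n0).
- by move=> s; rewrite -hullE; exact: facet_row_face (Ordinal n0).
- exact: facet_row_inj.
Qed.

End HardPolytopes.

(** * The choice of the number of edges *)

Lemma horner_le_power (R : realType) (sigma : {poly R}) :
  exists S : nat, forall N : nat, (0 < N)%N ->
    sigma.[N%:R] <= (S * N ^ size sigma)%:R.
Proof.
pose c := \sum_(i < size sigma) `|sigma`_i|.
exists (Num.bound c) => N N0.
rewrite natrM natrX horner_coef.
apply: (@le_trans _ _ (c * N%:R ^+ size sigma)); last first.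
  apply: ler_wpM2r; first by rewrite exprn_ge0.
  by apply/ltW/archi_boundP/sumr_ge0 => i _.
rewrite /c mulr_suml; apply: ler_sum => i _.
apply: (@le_trans _ _ (`|sigma`_i| * N%:R ^+ i)).
  by rewrite ler_wpM2r ?ler_norm // exprn_ge0.
rewrite ler_wpM2l //; apply: ler_weXn2l; last exact: ltnW.
by rewrite ler1n.
Qed.

(** With [f] edges the two descriptions have
    [4 (2 n + 1) + n f + 1 <= f ^ 2] rows in all; the coefficient bound [S] is
    absorbed by one factor [f], and the [+ 1] by another. *)
Lemma rows_lt_power S D n f r :
  (0 < D)%N -> (4 * (n + n + 1) + 2 + S <= f)%N ->
  (r <= S * (4 * (n + n + 1) + n * f + 1) ^ D)%N ->
  (r.+1 <= f ^ (2 * D + 2))%N.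
Proof.
move=> D0 fbig rS.
have f2 : (4 * (n + n + 1) + n * f + 1 <= f ^ 2)%N.
  by rewrite expnS expn1; nia.
have : (r <= f * f ^ (2 * D))%N.
  apply: leq_trans rS _; apply: leq_mul; first by lia.
  by rewrite expnM leq_exp2r.
rewrite -expnS => rf; rewrite addn2 expnS.
have : (0 < f ^ (2 * D).+1)%N by rewrite expn_gt0; lia.
nia.
Qed.

Theorem theorem4 (R : realType) (sigma : {poly R}) :
  exists (c : R) (d0 : nat), 0 < c /\
  forall d : nat, odd d ->
  exists (P1 P2 : set 'cV[R]_d) (m1 m2 f1 f2 : nat)
    (F1 : 'M[R]_(f1, d + m1)) (g1 : 'cV[R]_f1)
    (F2 : 'M[R]_(f2, d + m2)) (g2 : 'cV[R]_f2),
    [/\ P1 !=set0, P2 !=set0, formulation P1 F1 g1, formulation P2 F2 g2 &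
      forall (p q r : nat) (A : 'M[R]_(r, d)) (B : 'M[R]_(r, p))
        (C : 'M[R]_(r, q)) (h : 'cV[R]_r),
        mip_representation A B C h (P1 `|` P2) ->
        convex_hull_property A B C h P1 P2 ->
        r%:R <= sigma.[(f1 + f2)%:R] ->
        (d0 <= d)%N -> c * d%:R <= (p + q)%:R].
Proof.
have [S sigmaS] := horner_le_power sigma.
(* The exponent is one more than needed so as to be positive even when [sigma]
   is zero. *)
pose D := (size sigma).+1; pose K := (2 * D + 2)%N.
exists (4 * K)%:R^-1, (4 * K + 2)%N; split; first by rewrite invr_gt0 ltr0n.
move=> d od.
have [n ->] : exists n, d = (n + n + 1)%N.
  by exists d./2; rewrite -[LHS]odd_double_half od -addnn addnC.
pose f := (4 * (n + n + 1) + 2 + S)%N.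
have [F1 [g1 F1P]] : exists F g, formulation (@polygon_product R n f) F g :=
  boxed_formulation _ _ _ _.
have [F2 [g2 F2P]] : exists F g, formulation (@slice_polytope R n) F g :=
  boxed_formulation _ _ _ _.
exists (@polygon_product R n f), (@slice_polytope R n), 0%N, 0%N.
exists _, _, F1, g1, F2, g2; split=> //.
- by eexists; exact: polygon_product0.
- by exists 0; exact: slice_polytope0.
move=> p q r A B C h _ hullE rsigma dbig.
have n0 : (0 < n)%N by lia.
have hullE' : convex_hull (@polygon_product R n f `|` @slice_polytope R n) =
    shadow A (row_mx B C) h.
  rewrite hullE; apply/seteqP; split=> x /=.
    move=> [y [z ineqs]]; exists (col_mx y z) => i.
    by rewrite mul_row_col addrA; exact: ineqs.
  move=> [w ineqs]; exists (usubmx w), (dsubmx w) => i.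
  by have := ineqs i; rewrite -{1}[w]vsubmxK mul_row_col addrA.
have facets := hull_facets_le n0 hullE'.
have rK : (r.+1 <= f ^ K)%N.
  apply: (@rows_lt_power S D n) => //.
  rewrite -(ler_nat R); apply: le_trans rsigma _.
  rewrite card_prod !card_ord card_unit.
  set N := (X in sigma.[X%:R]).
  have NE : N = (4 * (n + n + 1) + n * f + 1)%N by rewrite /N; lia.
  rewrite -NE; apply: (le_trans (sigmaS N _)); first by rewrite NE addn1.
  rewrite ler_nat leq_mul2l; apply/orP; right; apply: leq_pexp2l => //.
  by rewrite NE addn1.
have nK : (n <= K * (p + q).+1)%N.
  have f1 : (1 < f)%N by rewrite /f; lia.
  rewrite -(leq_exp2l _ _ f1) expnM; apply: leq_trans facets _.
  by rewrite leq_exp2r.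
rewrite mulrC ler_pdivrMr ?ltr0n // -natrM ler_nat.
(* [2 n + 1 <= 2 K m + 2 K + 1], and [2 K + 1] is at most half the dimension. *)
move: dbig nK; rewrite mulnS; nia.
Qed.
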